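(* Let $d\ge1$, $\eta>0$, $\rho>0$, and let $f\in S(\mu_f,L_f)$, $\phi\in S(\mu_\phi,L_\phi)$ be functions $\mathbb{R}^d\to\mathbb{R}$ with $0<\mu_f<L_f$ and $0<\mu_\phi<L_\phi$. Let $\bar\phi,\mu_{\bar\phi},L_{\bar\phi}$ be as in the context, and define $$A=-\eta\mu_f\mu_{\bar\phi}I_d,\quad B=\begin{bmatrix}-\eta I_d&-\eta\mu_fI_d\end{bmatrix},\quad C=\begin{bmatrix}\mu_{\bar\phi}I_d \\ I_d\end{bmatrix},\quad D=\begin{bmatrix}0_d&I_d \\ 0_d&0_d\end{bmatrix},$$ $$K=\mathrm{diag}(L_f-\mu_f,\;L_{\bar\phi}-\mu_{\bar\phi})\otimes I_d .$$ Suppose there exist a symmetric positive definite matrix $P\in\mathbb{R}^{d\times d}$ and real numbers $\gamma,\alpha_1,\alpha_2\ge0$ such that, with $\Gamma=\mathrm{diag}(0,\gamma)\otimes I_d$ and $\alpha=\mathrm{diag}(\alpha_1,\alpha_2)\otimes I_d$, $$\begin{bmatrix}P\tilde A+\tilde A^TP+2\rho P & P\tilde B-\tilde C^T \\ (P\tilde B-\tilde C^T)^T & -(\tilde D+\tilde D^T)\end{bmatrix}\le0,$$ where $$\tilde A=A,\quad\tilde B=-B,\quad\tilde C=(\alpha+\rho\Gamma)C+\Gamma CA,\quad\tilde D=-\alpha D+\alpha K^{-1}-\Gamma CB .$$ Then the continuous-time mirror descent algorithm $$\dot z(t)=-\eta\,(\nabla f\circ\nabla\bar\phi)(z(t)),\qquad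 x(t)=\nabla\bar\phi(z(t)),$$ converges exponentially to the optimal solution of $\min_{x\in\mathbb{R}^d}f(x)$ with convergence rate $\rho$.
   Context: For $0\le\mu\le L$, $S(\mu,L)$ is the set of continuously differentiable functions $h:\mathbb{R}^d\to\mathbb{R}$ that are $\mu$-strongly convex and $L$-smooth, i.e. $\mu\|x-y\|^2\le(\nabla h(x)-\nabla h(y))^T(x-y)\le L\|x-y\|^2$ for all $x,y$. The convex conjugate of $\phi$ is $\bar\phi(z)=\sup_x\{x^Tz-\phi(x)\}$. Set $\mu_{\bar\phi}=L_\phi^{-1}$, $L_{\bar\phi}=\mu_\phi^{-1}$. Then $\bar\phi\in S(\mu_{\bar\phi},L_{\bar\phi})$ and $\nabla\bar\phi$ is the inverse function of $\nabla\phi$. The optimal solution is $x^{\mathrm{opt}}$, the minimizer of $f$ over $\mathbb{R}^d$, and $z^{\mathrm{opt}}=\nabla\phi(x^{\mathrm{opt}})$ is the corresponding equilibrium. Exponential convergence with rate $\rho$ means: there is a constant $c>0$ such that for every initial condition $z(0)\in\mathbb{R}^d$, $\|z(t)-z^{\mathrm{opt}}\|\le c\,e^{-\rho t}\|z(0)-z^{\mathrm{opt}}\|$ for all $t\ge0$ (and hence, $\nabla\bar\phi$ being Lipschitz with Lipschitz inverse, $x(t)\to x^{\mathrm{opt}}$ at the same exponential rate). $I_d$ and $0_d$ are the $d\times d$ identity and zero matrices, $\otimes$ is the Kronecker product, and $\le0$ for symmetric matrices means negative semidefinite. *)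

(* Defs.v *)
From mathcomp Require Import all_boot all_order all_algebra.
From mathcomp Require Import all_classical all_reals all_analysis.
From mathcomp Require Import mxtens.
Import Order.TTheory GRing.Theory Num.Theory.
Import numFieldNormedType.Exports.
Set Implicit Arguments.
Unset Strict Implicit.
Unset Printing Implicit Defensive.
Local Open Scope classical_set_scope.
Local Open Scope ring_scope.

Definition dotp (R : realType) (d : nat) (x y : 'cV[R]_d) : R :=
  (x^T *m y) 0 0.

(* The library norm `|x| on matrices is the sup norm; this one is Euclidean. *)
Definition enorm (R : realType) (d : nat) (x : 'cV[R]_d) : R :=
  Num.sqrt (dotp x x).

(* Meaningful at points of differentiability. *)
Definition grad (R : realType) (d : nat) (h : 'cV[R]_d -> R) (x : 'cV[R]_d)
    : 'cV[R]_d :=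
  \col_i 'D_(delta_mx i 0) h x.

Definition S_class (R : realType) (d : nat) (mu L : R) (h : 'cV[R]_d -> R) :
    Prop :=
  [/\ forall x, differentiable h x,
      continuous (grad h) &
      forall x y,
        mu * enorm (x - y) ^+ 2 <= dotp (grad h x - grad h y) (x - y)
                                <= L * enorm (x - y) ^+ 2].

(* Real-valued supremum: for phi in S_class mu L with 0 < mu the set below is
   nonempty and bounded above at every z, so no junk value occurs. *)
Definition convex_conjugate (R : realType) (d : nat) (phi : 'cV[R]_d -> R)
    (z : 'cV[R]_d) : R :=
  sup [set dotp x z - phi x | x in [set: 'cV[R]_d]].

Definition is_minimizer (R : realType) (d : nat) (f : 'cV[R]_d -> R)
    (x : 'cV[R]_d) : Prop :=
  forall y, f x <= f y.

(* z and x are trajectories on [0, +oo[; their values at negative times are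
   irrelevant. Asking for the equation at t > 0 and continuity up to t = 0
   includes every solution that is one-sidedly differentiable at 0. *)
Definition mirror_descent (R : realType) (d : nat) (eta : R)
    (f phi : 'cV[R]_d -> R) (z x : R -> 'cV[R]_d) : Prop :=
  [/\ {within `[0, +oo[, continuous z},
      forall t : R, 0 < t ->
        is_derive t 1 z
          (- eta *: (grad f \o grad (convex_conjugate phi)) (z t)) &
      forall t : R, 0 <= t -> x t = grad (convex_conjugate phi) (z t)].

Definition posdefmx (R : realType) (n : nat) (M : 'M[R]_n) : Prop :=
  M^T = M /\ forall v : 'cV[R]_n, v != 0 -> 0 < (v^T *m M *m v) 0 0.

Definition negsemidefmx (R : realType) (n : nat) (M : 'M[R]_n) : Prop :=
  M^T = M /\ forall v : 'cV[R]_n, (v^T *m M *m v) 0 0 <= 0.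

Lemma mul2nD (d : nat) : (2 * d = d + d)%N.
Proof. by rewrite mul2n addnn. Qed.

(* diag(a, b) (x) I_d; the cast only retypes the size 2 * d as d + d. *)
Definition diag2I (R : realType) (d : nat) (a b : R) : 'M[R]_(d + d) :=
  castmx (mul2nD d, mul2nD d)
    (tensmx (diag_mx (\row_(i < 2) [:: a; b]`_i)) (1%:M : 'M[R]_d)).

Lemma diag2IE (R : realType) (d : nat) (a b : R) :
  diag2I d a b = block_mx a%:M 0 0 b%:M.
Proof.
have ixl (i : 'I_d) :
    cast_ord (esym (mul2nD d)) (lshift d i) = mxtens_index (0 : 'I_2, i).
  by apply: val_inj; rewrite /= mul0n.
have ixr (i : 'I_d) :
    cast_ord (esym (mul2nD d)) (rshift d i) = mxtens_index (1 : 'I_2, i).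
  by apply: val_inj; rewrite /= mul1n.
apply/matrixP => i j; rewrite castmxE.
case: (split_ordP i) => k ->; case: (split_ordP j) => l ->;
  rewrite ?ixl ?ixr tensmxE ?block_mxEul ?block_mxEur ?block_mxEdl
    ?block_mxEdr !mxE /=;
  by rewrite ?mulr1n ?mulr0n ?mul0r ?mulr_natr.
Qed.

(* Main.v *)
Require Import Defs.
From mathcomp Require Import all_boot all_order all_algebra.
From mathcomp Require Import all_classical all_reals all_analysis.
From mathcomp Require Import ring lra.
Import Order.TTheory GRing.Theory Num.Theory.
Import numFieldNormedType.Exports.
Local Open Scope classical_set_scope.
Local Open Scope ring_scope.

(** The Lyapunov function is the Bregman divergence of [phi] from the optimum,
    V = phi xopt - phi x - <grad phi x, xopt - x>, read along a trajectory.
    In the dual variable z = grad phi x it equals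
    conj z - conj zopt - <xopt, z - zopt>, where conj is the convex conjugate,
    whose gradient inverts [grad phi] ([conjugate_bregman],
    [grad_conjugate]).  Hence dV/dt = <x - xopt, dz/dt>, and since
    dz/dt = - eta grad f x and grad f xopt = 0, strong convexity of f gives
    dV/dt <= - eta muf |x - xopt|^2.  Smoothness of phi bounds V above by
    Lphi/2 |x - xopt|^2, so dV/dt <= - 2 (eta muf / Lphi) V and V decays at
    rate 2 eta muf / Lphi ([bregman_decay]).

    Now V is equivalent to |x - xopt|^2 ([bregman_ge], [bregman_le]) and also
    controls |z - zopt|^2 ([bregman_ge_grad]); taking square roots, x and z
    both converge at rate eta muf / Lphi.

    The matrix inequality enters through its upper-left block, which is
    equal to P A + A^T P + 2 rho P = 2 (rho - eta muf / Lphi) P, and P is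
    positive definite, so the inequality forces rho <= eta muf / Lphi
    ([lmi_rate]).

    The analytic groundwork is the calculus of conj.  Surjectivity of
    [grad phi] comes from minimizing phi - <z, .> on a large box
    ([grad_surj]); then conj z' - conj z - <x, z' - z> is itself a Bregman
    divergence of phi, hence quadratically small in z' - z
    ([conjugate_expansion]).  That single estimate yields the gradient of
    conj, its continuity, and its derivative along curves. *)

Section MirrorDescent.
Context {R : realType} {d : nat}.
Implicit Types (f h phi : 'cV[R]_d -> R) (x y z w : 'cV[R]_d) (a : R).

(** * Euclidean inner product *)

Lemma dotpE x y : dotp x y = \sum_i x i 0 * y i 0.
Proof. by rewrite /dotp mxE; apply: eq_bigr => i _; rewrite mxE. Qed.

Lemma dotpC x y : dotp x y = dotp y x.
Proof. by rewrite !dotpE; apply: eq_bigr => i _; rewrite mulrC. Qed.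

Lemma dotpDr x y w : dotp x (y + w) = dotp x y + dotp x w.
Proof. by rewrite /dotp mulmxDr mxE. Qed.

Lemma dotpZr a x y : dotp x (a *: y) = a * dotp x y.
Proof. by rewrite /dotp -scalemxAr mxE. Qed.

Lemma dotpNr x y : dotp x (- y) = - dotp x y.
Proof. by rewrite -scaleN1r dotpZr mulN1r. Qed.

Lemma dotpDl x y w : dotp (x + y) w = dotp x w + dotp y w.
Proof. by rewrite ![dotp _ w]dotpC dotpDr. Qed.

Lemma dotpZl a x y : dotp (a *: x) y = a * dotp x y.
Proof. by rewrite ![dotp _ y]dotpC dotpZr. Qed.

Lemma dotpNl x y : dotp (- x) y = - dotp x y.
Proof. by rewrite ![dotp _ y]dotpC dotpNr. Qed.

Definition dotpL := (dotpDl, dotpNl, dotpZl, dotpDr, dotpNr, dotpZr).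

Lemma dotp_ge0 x : 0 <= dotp x x.
Proof. by rewrite dotpE sumr_ge0// => i _; rewrite -expr2 sqr_ge0. Qed.

Lemma coord_sqr_le_dotp x i : x i 0 ^+ 2 <= dotp x x.
Proof.
rewrite dotpE (bigD1 i)//= -expr2 lerDl sumr_ge0// => j _.
by rewrite -expr2 sqr_ge0.
Qed.

Lemma dotp_eq0 x : dotp x x <= 0 -> x = 0.
Proof.
move=> x0; apply/matrixP => i j; rewrite (ord1 j) mxE; apply/eqP.
by rewrite -sqrf_eq0 eq_le sqr_ge0 (le_trans (coord_sqr_le_dotp x i) x0).
Qed.

(** The right-hand side exceeds the left by |a x - y|^2 / (2 a).  This replaces
    the Cauchy-Schwarz inequality throughout. *)
Lemma dotp_young a x y : 0 < a ->
  dotp x y <= a / 2 * dotp x x + (2 * a)^-1 * dotp y y.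
Proof.
move=> a0; have := dotp_ge0 (a *: x - y); rewrite !dotpL (dotpC y x) => h.
rewrite -(ler_pM2l a0); have -> : a * (a / 2 * dotp x x + (2 * a)^-1 * dotp y y)
    = (a * (a * dotp x x) + dotp y y) / 2 by field; lra.
by lra.
Qed.

Lemma enorm_sqr x : enorm x ^+ 2 = dotp x x.
Proof. by rewrite /enorm sqr_sqrtr// dotp_ge0. Qed.

Lemma enorm_ge0 x : 0 <= enorm x.
Proof. exact: sqrtr_ge0. Qed.

Lemma dotp0 x : dotp x 0 = 0.
Proof. by rewrite /dotp mulmx0 mxE. Qed.

Lemma dot0p x : dotp 0 x = 0.
Proof. by rewrite dotpC dotp0. Qed.

Lemma dotp_subC x y : dotp (x - y) (x - y) = dotp (y - x) (y - x).
Proof. by rewrite -opprB dotpNl dotpNr opprK. Qed.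

Lemma enorm_le_expR (r c t : R) (u v : 'cV[R]_d) : 0 <= c ->
  dotp u u <= c ^+ 2 * (expR (- (2 * r * t)) * dotp v v) ->
  enorm u <= c * expR (- (r * t)) * enorm v.
Proof.
move=> c0 h.
rewrite -ler_sqr ?nnegrE ?enorm_ge0 ?mulr_ge0 ?expR_ge0 ?enorm_ge0//.
rewrite !exprMn !enorm_sqr -expRM_natl -mulrA.
by have -> : 2%:R * - (r * t) = - (2 * r * t) by ring.
Qed.

Lemma cvg_dotp {T : Type} {F : set_system T} {FF : Filter F}
    (a b : T -> 'cV[R]_d) u v :
  a @ F --> u -> b @ F --> v ->
  (fun s => dotp (a s) (b s)) @ F --> dotp u v.
Proof.
move=> au bv; rewrite dotpE; under eq_fun do rewrite dotpE.
apply: (@cvg_big _ _ +%R) => [|i _]; first exact: add_continuous.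
apply: cvgM.
  exact: (cvg_comp _ _ au (@coord_continuous R d 1 i 0 u)).
exact: (cvg_comp _ _ bv (@coord_continuous R d 1 i 0 v)).
Qed.

(** * Derivatives along curves *)

Lemma is_derive_coord (z : R -> 'cV[R]_d) (t : R) v i :
  is_derive t 1 z v -> is_derive t 1 (fun s => z s i 0) (v i 0).
Proof.
move=> [dz <-]; split; first by move/derivable_mxP : dz; exact.
by rewrite derive_mx// mxE.
Qed.

Lemma is_derive_dotp (y z : R -> 'cV[R]_d) (t : R) u v :
  is_derive t 1 y u -> is_derive t 1 z v ->
  is_derive t 1 (fun s => dotp (y s) (z s)) (dotp u (z t) + dotp (y t) v).
Proof.
move=> dy dz.
have -> : (fun s => dotp (y s) (z s)) =
    \sum_(i < d) (fun s => y s i 0 * z s i 0).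
  by apply/funext => s; rewrite fct_sumE dotpE.
have h i : is_derive t 1 (fun s => y s i 0 * z s i 0)
    (y t i 0 * v i 0 + z t i 0 * u i 0).
  exact: (is_deriveM (is_derive_coord _ _ _ i dy) (is_derive_coord _ _ _ i dz)).
apply: is_derive_eq; rewrite !dotpE -big_split/=; apply: eq_bigr => i _.
by rewrite addrC [u i 0 * _]mulrC.
Qed.

(** The increments of [H] are at most those of [E], whose difference quotient
    tends to 0. *)
Lemma is_derive_dominated (H E : R -> R) (t : R) :
  E t = 0 -> is_derive t 1 E 0 -> (forall s, `|H s - H t| <= E s) ->
  is_derive t 1 H 0.
Proof.
move=> E0 [dE dE0] HE.
have cE : (fun r => r^-1 *: (E (r *: 1 + t) - E t)) @ 0^' --> (0 : R).
  have : (fun r => r^-1 *: (E (r *: 1 + t) - E t)) @ 0^' --> 'D_1 E t.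
    by exact: dE.
  by rewrite dE0.
have cH : (fun r => r^-1 *: (H (r *: 1 + t) - H t)) @ 0^' --> (0 : R).
  apply/norm_cvg0P; apply: (squeeze_cvgr _ (cvg_cst 0)); last first.
    exact: (norm_cvg0P _).2 cE.
  near=> r; rewrite normr_ge0/= !normrM ler_wpM2l//.
  by rewrite E0 subr0 (le_trans (HE _))// ler_norm.
by split; [apply/cvg_ex; exists 0|apply/cvg_lim].
Unshelve. all: by end_near. Qed.

(** A first-order expansion of [F] along [z] with error quadratic in the
    displacement determines the derivative: the error has derivative 0 because
    it is squeezed by k |z s - z t|^2.  Stating it along a curve serves both
    for trajectories and, with straight lines, for partial derivatives. *)
Lemma is_derive_sandwich (F : R -> R) (z : R -> 'cV[R]_d) (t : R) v g k :
  is_derive t 1 z v ->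
  (forall s, `|F s - F t - dotp g (z s - z t)|
             <= k * dotp (z s - z t) (z s - z t)) ->
  is_derive t 1 F (dotp g v).
Proof.
move=> dz Fz.
have dc (w : 'cV[R]_d) : is_derive t 1 (fun=> w) 0 by exact: is_derive_cst.
have dzt : is_derive t 1 (fun s => z s - z t) v.
  by apply: is_derive_eq; rewrite subr0.
have dg : is_derive t 1 (fun s => dotp g (z s - z t)) (dotp g v).
  apply: is_derive_eq (is_derive_dotp _ _ _ _ _ (dc g) dzt) _.
  by rewrite subrr dot0p add0r.
have dH : is_derive t 1 (fun s => F s - dotp g (z s - z t)) 0.
  apply: (@is_derive_dominated _
    (fun s => k * dotp (z s - z t) (z s - z t))).
  - by rewrite subrr dotp0 mulr0.
  - apply: is_derive_eq (is_deriveZ k (is_derive_dotp _ _ _ _ _ dzt dzt)) _.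
    by rewrite subrr dot0p dotp0 addr0 scaler0.
  - by move=> s; rewrite subrr dotp0 subr0 addrAC.
have -> : F =
    (fun s => F s - dotp g (z s - z t)) \+ (fun s => dotp g (z s - z t)).
  by apply/funext => s /=; rewrite subrK.
by apply: is_derive_eq; rewrite add0r.
Qed.

(** * Bregman divergence of a function of class S *)

Definition bregman h y x := h y - h x - dotp (grad h x) (y - x).

Lemma is_derive_line h x v (s : R) : (forall y, differentiable h y) ->
  is_derive s 1 (fun r => h (x + r *: v)) (dotp (grad h (x + s *: v)) v).
Proof.
move=> dh.
have E : (fun k : R => k^-1 *: (h (x + (k *: 1 + s) *: v) - h (x + s *: v)))
   = (fun k : R => k^-1 *: (h (k *: v + (x + s *: v)) - h (x + s *: v))).
  apply/funext => k; congr (_ *: (h _ - _)).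
  by rewrite scalerDl [k *: 1]mulr1 addrCA.
split; first by rewrite /derivable E; exact: diff_derivable.
rewrite /derive E -/(derive h (x + s *: v) v) deriveE//.
move: (x + s *: v) => p.
have vE : v = \sum_i v i 0 *: (delta_mx i 0 : 'cV[R]_d).
  rewrite {1}(matrix_sum_delta v); apply: eq_bigr => i _.
  by rewrite big_ord1.
rewrite {1}vE linear_sum dotpE; apply: eq_bigr => i _.
by rewrite linearZ/= -deriveE// mxE mulrC.
Qed.

(** The mean value theorem applied to
    s |-> h (x + s v) - s <grad h x, v> - m/2 s^2 |v|^2 on [0, 1], v = y - x.
    The equation is multiplied by the intermediate point [c] so that its
    right-hand side involves the displacement c v alone: for m = mu or m = L
    its sign is then exactly what [S_class] prescribes for the pair
    x + c v, x. *)
Lemma bregman_mvt h m x y : (forall y, differentiable h y) ->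
  exists2 c : R, 0 < c &
    c * (bregman h y x - m / 2 * dotp (y - x) (y - x)) =
    dotp (grad h (x + c *: (y - x)) - grad h x) (c *: (y - x)) -
    m * dotp (c *: (y - x)) (c *: (y - x)).
Proof.
move=> dh; set v := y - x.
pose p (s : R) := h (x + s *: v) -
   (s * dotp (grad h x) v + m / 2 * dotp v v * s ^+ 2).
pose dp (s : R) := dotp (grad h (x + s *: v)) v -
   (dotp (grad h x) v + m * s * dotp v v).
have pd (s : R) : is_derive s 1 p (dp s).
  have := is_derive_line h x v s dh => dl.
  rewrite /p /dp; apply: is_derive_eq.
  by rewrite /GRing.scale/= mulr0; field.
have cp : {within `[0, 1], continuous p}.
  apply: derivable_within_continuous => s _; exact: ex_derive.
have [c c01 pE] := MVT (@ltr01 R) (fun s _ => pd s) cp.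
exists c; first by move: c01; rewrite in_itv/= => /andP[].
move: pE; rewrite /p /dp scale1r scale0r addr0 [x + v]addrC subrK.
rewrite /bregman => pE.
rewrite -/v; clearbody v; clear p dp pd cp; rewrite !dotpL.
have -> : h y = h x + dotp (grad h (x + c *: v)) v - m * c * dotp v v
    + m / 2 * dotp v v by lra.
by field.
Qed.

Lemma bregman_ge mu L h x y : S_class mu L h ->
  mu / 2 * dotp (y - x) (y - x) <= bregman h y x.
Proof.
move=> [dh _ hS]; have [c c0 cE] := bregman_mvt h mu x y dh.
rewrite -subr_ge0 -(pmulr_rge0 _ c0) cE subr_ge0.
have := hS (x + c *: (y - x)) x.
by rewrite [x + _]addrC addrK enorm_sqr => /andP[].
Qed.

Lemma bregman_le mu L h x y : S_class mu L h ->
  bregman h y x <= L / 2 * dotp (y - x) (y - x).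
Proof.
move=> [dh _ hS]; have [c c0 cE] := bregman_mvt h L x y dh.
rewrite -subr_le0 -(pmulr_rle0 _ c0) cE subr_le0.
have := hS (x + c *: (y - x)) x.
by rewrite [x + _]addrC addrK enorm_sqr => /andP[].
Qed.

Lemma bregman_ge0 mu L h x y : S_class mu L h -> 0 < mu -> 0 <= bregman h y x.
Proof.
move=> hS mu0; apply: le_trans (bregman_ge _ _ _ x y hS).
by rewrite mulr_ge0 ?dotp_ge0// divr_ge0 ?ltW.
Qed.

(** One gradient step of length 1/L from [y] decreases the smooth function
    h - <z, .> by at least |grad h y - z|^2 / (2 L), and cannot go below the
    minimum reached at [x]. *)
Lemma descent_gap mu L h z x y : S_class mu L h -> 0 < L ->
  (forall w, h x - dotp z x <= h w - dotp z w) ->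
  (2 * L)^-1 * dotp (grad h y - z) (grad h y - z) <=
    (h y - dotp z y) - (h x - dotp z x).
Proof.
move=> hS L0 xmin; set u := grad h y - z.
have := xmin (y - L^-1 *: u); have := bregman_le _ _ _ y (y - L^-1 *: u) hS.
rewrite /bregman (addrC y) addrK.
have -> : L / 2 * dotp (- (L^-1 *: u)) (- (L^-1 *: u)) = (2 * L)^-1 * dotp u u.
  by rewrite !dotpL; field; lra.
have -> : dotp (grad h y) (- (L^-1 *: u)) =
    - (2 * ((2 * L)^-1 * dotp u u)) - L^-1 * dotp z u.
  have -> : grad h y = u + z by rewrite /u subrK.
  by rewrite !dotpL; field; lra.
by rewrite (dotpDr z _ y) (dotpNr z) (dotpZr _ z); lra.
Qed.

(** This is [descent_gap] with [y] equal to the minimizer: the gap is 0. *)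
Lemma grad_of_minimizer mu L h z x : S_class mu L h -> 0 < L ->
  (forall w, h x - dotp z x <= h w - dotp z w) -> grad h x = z.
Proof.
move=> hS L0 xmin; have := descent_gap _ _ _ _ _ x hS L0 xmin.
rewrite subrr pmulr_rle0 ?invr_gt0 ?mulr_gt0// => /dotp_eq0/eqP.
by rewrite subr_eq0 => /eqP.
Qed.

(** By convexity [x] minimizes h - <grad h x, .>, and the Bregman divergence is
    the gap of that function at [y].  This bounds dual displacements by the
    divergence without a separate proof that the gradient is Lipschitz. *)
Lemma bregman_ge_grad mu L h x y : S_class mu L h -> 0 < mu -> 0 < L ->
  (2 * L)^-1 * dotp (grad h y - grad h x) (grad h y - grad h x) <=
    bregman h y x.
Proof.
move=> hS mu0 L0; have -> : bregman h y x =
    h y - dotp (grad h x) y - (h x - dotp (grad h x) x).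
  by rewrite /bregman dotpDr dotpNr; ring.
apply: (descent_gap _ _ _ _ _ _ hS L0) => w.
have := bregman_ge0 _ _ _ x w hS mu0.
by rewrite /bregman dotpDr dotpNr; lra.
Qed.

(** * Inverting the gradient *)

(** Carries the extreme value theorem over from boxes of row vectors to columns. *)
Lemma trmx_continuous : continuous (@trmx R 1 d).
Proof.
move=> v A [N Nv NA]; exists (fun i j => N j i).
  by move=> i j; have := Nv j i; rewrite mxE.
by move=> w wN; apply: NA => i j; rewrite mxE; exact: wN.
Qed.

(** A minimizer of h - <z, .> has gradient z.  Strong convexity makes this
    function exceed its value at 0 outside a large box, so a minimizer over the
    compact box is a global one. *)
Lemma grad_surj mu L h z : S_class mu L h -> 0 < mu -> 0 < L ->
  exists x, grad h x = z.
Proof.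
move=> hS mu0 L0; pose k x := h x - dotp z x.
suff [x xmin] : exists x, forall w, k x <= k w.
  by exists x; exact: grad_of_minimizer hS L0 xmin.
pose g := grad h 0 - z.
(* The lower bound g.w + mu/2 |w|^2 is nonnegative once |w|^2 >= 4 |g|^2 / mu^2;
   adding 1 gives M <= M^2, which avoids a square root. *)
pose M := 1 + 4 / mu ^+ 2 * dotp g g.
have M1 : 1 <= M.
  by rewrite /M lerDl mulr_ge0 ?dotp_ge0// divr_ge0// sqr_ge0.
pose A := [set v : 'rV[R]_d | forall i, `[- M, M]%classic (v ord0 i)].
have A0 : A 0 by move=> i; rewrite /= in_itv/= mxE; apply/andP; split; lra.
have cA : compact A.
  apply: (@rV_compact R d (fun=> `[- M, M]%classic)) => _.
  exact: segment_compact.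
have ck : continuous k.
  move=> x; apply: continuousB.
    by case: hS => dh _ _; exact/differentiable_continuous/dh.
  have -> : dotp z = \sum_i (fun x => z i 0 * x i 0).
    by apply/funext => y; rewrite dotpE fct_sumE.
  apply/differentiable_continuous/differentiable_sum => i.
  exact/differentiableZ/differentiable_coord.
have [|x xA xmin] := @compact_EVT_min _ _ (k \o trmx) A (ex_intro _ _ A0) cA.
  apply: continuous_subspaceT => v; apply: continuous_comp; last exact: ck.
  exact: trmx_continuous.
exists x^T => w; have [wA|wA] := pselect (A w^T).
  by have := xmin w^T; rewrite inE/= trmxK => /(_ wA).
have kx0 : k x^T <= k 0.
  by have := xmin 0; rewrite inE/= trmx0 => /(_ A0).
apply: (le_trans kx0).
have Mw : M ^+ 2 <= dotp w w.
  have [i wi] : exists i, ~ `[- M, M]%classic (w^T ord0 i) by exact/existsNP.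
  apply: le_trans (coord_sqr_le_dotp _ i).
  move: wi; rewrite /= in_itv/= mxE -ler_norml => /negP; rewrite -ltNge => wi.
  by rewrite -[leRHS]real_normK ?num_real// ler_sqr ?nnegrE//; lra.
have GW : mu^-1 * dotp g g <= mu / 4 * dotp w w.
  have MM : 4 / mu ^+ 2 * dotp g g <= dotp w w.
    apply: le_trans Mw; apply: (@le_trans _ _ M);
      by rewrite ?ler_eXnr// /M; lra.
  rewrite -(ler_pM2l (_ : 0 < 4 / mu)) ?divr_gt0//.
  apply: le_trans (le_trans MM _); rewrite le_eqVlt; apply/orP; left;
    by apply/eqP; field; lra.
have := dotp_young (mu / 2) (- w) g (divr_gt0 mu0 (ltr0Sn R 1)).
have := bregman_ge _ _ _ 0 w hS; rewrite /bregman subr0 /k.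
have -> : dotp (grad h 0) w = dotp g w + dotp z w by rewrite -dotpDl subrK.
rewrite dotp0; have -> : 2 * (mu / 2) = mu by field.
by move: GW; clearbody g; rewrite !dotpL opprK (dotpC w g) => *; lra.
Qed.

(** * The conjugate function *)

(** Strong monotonicity and Young's inequality with weight mu:
    mu |x - y|^2 <= <grad h x - grad h y, x - y>
    <= mu/2 |x - y|^2 + |grad h x - grad h y|^2 / (2 mu). *)
Lemma grad_inverse_lipschitz mu L h x y : S_class mu L h -> 0 < mu ->
  mu ^+ 2 * dotp (x - y) (x - y) <=
    dotp (grad h x - grad h y) (grad h x - grad h y).
Proof.
move=> [_ _ hS] mu0; have := hS x y; rewrite enorm_sqr => /andP[+ _].
have := dotp_young mu (x - y) (grad h x - grad h y) mu0.
rewrite [dotp (x - y) (_ - _)]dotpC.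
move: (dotp _ (x - y)) => b; move: (dotp _ _) => a.
move: (dotp _ _) => c h1 h2.
have h3 : mu / 2 * a <= (2 * mu)^-1 * c by lra.
have mm : 0 < 2 * mu by lra.
move: h3; rewrite -(ler_pM2l mm) mulVKf ?gt_eqF//.
by apply: le_trans; rewrite le_eqVlt; apply/orP; left; apply/eqP; field.
Qed.

(** Equality case of the Fenchel-Young inequality: the supremum defining the
    conjugate is attained at [x] because the Bregman divergence is
    nonnegative. *)
Lemma conjugate_at_grad mu L h x : S_class mu L h -> 0 < mu ->
  convex_conjugate h (grad h x) = dotp x (grad h x) - h x.
Proof.
move=> hS mu0.
have ubx : ubound [set dotp y (grad h x) - h y | y in [set: 'cV[R]_d]]
    (dotp x (grad h x) - h x).
  move=> _ [y _ <-]; have := bregman_ge0 _ _ _ x y hS mu0.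
  by rewrite /bregman dotpDr dotpNr !(dotpC (grad h x)); lra.
apply/eqP; rewrite eq_le; apply/andP; split.
  by apply: ge_sup => //; exists (dotp 0 (grad h x) - h 0); exists 0.
by apply: ub_le_sup; [exists (dotp x (grad h x) - h x)|exists x].
Qed.

(** The duality between the Bregman divergences of [h] and of its conjugate,
    with the two points exchanged. *)
Lemma conjugate_bregman mu L h x y : S_class mu L h -> 0 < mu ->
  convex_conjugate h (grad h y) - convex_conjugate h (grad h x)
    - dotp x (grad h y - grad h x) = bregman h x y.
Proof.
move=> hS mu0; rewrite !(conjugate_at_grad _ _ _ _ hS mu0) /bregman.
by rewrite !dotpL !(dotpC (grad h y)); ring.
Qed.

(** The error is a Bregman divergence of [h], at most L/2 |x - y|^2 with
    grad h y = z, and |x - y| <= |z - grad h x| / mu. *)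
Lemma conjugate_expansion mu L h x z : S_class mu L h -> 0 < mu -> 0 < L ->
  `|convex_conjugate h z - convex_conjugate h (grad h x)
    - dotp x (z - grad h x)| <=
  L / (2 * mu ^+ 2) * dotp (z - grad h x) (z - grad h x).
Proof.
move=> hS mu0 L0; have [y <-] := grad_surj _ _ _ z hS mu0 L0.
rewrite (conjugate_bregman _ _ _ _ _ hS mu0).
rewrite ger0_norm ?(bregman_ge0 _ _ _ _ _ hS)//.
apply: le_trans (bregman_le _ _ _ _ _ hS) _.
have := grad_inverse_lipschitz _ _ _ x y hS mu0.
rewrite -[grad h y - _]opprB dotpNl dotpNr opprK.
move: (dotp _ _) (dotp (x - y) _) => b a ab.
have -> : L / 2 * a = L / (2 * mu ^+ 2) * (mu ^+ 2 * a) by field; lra.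
by rewrite ler_wpM2l// divr_ge0 ?mulr_ge0 ?sqr_ge0 ?ltW.
Qed.

Lemma is_derive_conjugate mu L h (z : R -> 'cV[R]_d) (t : R) v x :
  S_class mu L h -> 0 < mu -> 0 < L -> is_derive t 1 z v -> z t = grad h x ->
  is_derive t 1 (fun s => convex_conjugate h (z s)) (dotp x v).
Proof.
move=> hS mu0 L0 dz zt.
apply: (is_derive_sandwich _ _ _ _ _ (L / (2 * mu ^+ 2)) dz) => s.
by rewrite zt; exact: conjugate_expansion.
Qed.

(** Stated for an arbitrary filter so that it applies to a trajectory near the
    endpoint 0 of its interval of definition. *)
Lemma cvg_conjugate mu L h {T : Type} {F : set_system T} {FF : Filter F}
    (y : T -> 'cV[R]_d) z : S_class mu L h -> 0 < mu -> 0 < L ->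
  y @ F --> z ->
  (fun s => convex_conjugate h (y s)) @ F --> convex_conjugate h z.
Proof.
move=> hS mu0 L0 yz; have [x zE] := grad_surj _ _ _ z hS mu0 L0.
set k := L / (2 * mu ^+ 2).
have dy : (fun s => y s - z) @ F --> (0 : 'cV[R]_d).
  by rewrite -(subrr z); apply: cvgB => //; exact: cvg_cst.
have nz : (fun s => convex_conjugate h (y s) - convex_conjugate h z
    - dotp x (y s - z)) @ F --> (0 : R).
  apply/norm_cvg0P.
  apply: (@squeeze_cvgr _ _ _ R (fun=> 0)
      (fun s => k * dotp (y s - z) (y s - z))).
  - by near=> s; rewrite normr_ge0/= -zE; exact: conjugate_expansion.
  - exact: cvg_cst.
  - rewrite -(mulr0 k); apply: cvgMl_tmp.
    by rewrite -[X in _ --> X](dotp0 0); exact: cvg_dotp.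
have -> : (fun s => convex_conjugate h (y s)) = (fun s =>
    (convex_conjugate h (y s) - convex_conjugate h z - dotp x (y s - z))
    + (convex_conjugate h z + dotp x (y s - z))).
  by apply/funext => s; ring.
rewrite -[X in _ --> X]add0r; apply: cvgD => //.
rewrite -[X in _ --> X]addr0; apply: cvgD; first exact: cvg_cst.
by rewrite -[X in _ --> X](dotp0 x); apply: cvg_dotp => //; exact: cvg_cst.
Unshelve. all: by end_near. Qed.

Lemma grad_conjugate mu L h x : S_class mu L h -> 0 < mu -> 0 < L ->
  grad (convex_conjugate h) (grad h x) = x.
Proof.
move=> hS mu0 L0; apply/matrixP => i j; rewrite (ord1 j) mxE.
set z := grad h x; set e : 'cV[R]_d := delta_mx i 0.
have dline : is_derive (0 : R) 1 (fun s : R => s *: e + z) e.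
  have ds : is_derive (0 : R) 1 (fun s : R => s *: e) e.
    have := is_diff_scalel (0 : R) e => de.
    split; first exact/diff_derivable/ex_diff.
    by rewrite deriveE ?diff_val ?scale1r//; exact: ex_diff.
  by apply: is_derive_eq; rewrite addr0.
have zE : (0 : R) *: e + z = grad h x by rewrite scale0r add0r.
have [_] := is_derive_conjugate _ _ _ _ _ _ _ hS mu0 L0 dline zE.
rewrite /derive scale0r add0r /=.
under eq_fun do rewrite addr0 [_%:A]mulr1.
move=> ->; rewrite dotpE (bigD1 i)//= big1 ?addr0 => [|k ki].
  by rewrite mxE !eqxx mulr1.
by rewrite mxE (negbTE ki) mulr0.
Qed.

(** * Exponential decay of the Bregman divergence *)

(** The product expR (r t) W t has a nonpositive derivative for t > 0 and is
    continuous up to 0, so it never exceeds its initial value. *)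
Lemma gronwall_decay (r : R) (W : R -> R) :
  {within `[0, +oo[, continuous W} ->
  (forall t : R, 0 < t -> exists2 w, is_derive t 1 W w & w <= - (r * W t)) ->
  forall t, 0 <= t -> W t <= expR (- (r * t)) * W 0.
Proof.
move=> cW dW t t0.
pose E (s : R) := expR (r * s) * W s.
have dE (s : R) : 0 < s -> exists2 e, is_derive s 1 E e & e <= 0.
  move=> s0; have [w ww wle] := dW s s0.
  exists (expR (r * s) * w + W s * (r * expR (r * s))).
    rewrite /E.
    have d1 : is_derive s 1 (fun s => expR (r * s)) (r * expR (r * s)).
      by apply: is_derive_eq; rewrite /GRing.scale/= mulr1 mulrC.
    exact: is_deriveM.
  have -> : expR (r * s) * w + W s * (r * expR (r * s)) =
     expR (r * s) * (w + r * W s) by ring.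
  by rewrite pmulr_rle0 ?expR_gt0//; lra.
have cE : {within `[0, +oo[, continuous E}.
  move=> s; apply: cvgM; last exact: cW.
  apply: continuous_subspaceT => {}s.
  apply: continuous_comp; last exact: continuous_expR.
  exact: mulrl_continuous.
have := @ler0_derive1_nincry _ E 0 _ _ cE 0 t (lexx _) t0.
rewrite /E mulr0 expR0 mul1r => h.
have {}h : expR (r * t) * W t <= W 0.
  apply: h => s; rewrite in_itv/= andbT => s0; have [e de ele] := dE s s0.
    exact: ex_derive.
  by rewrite derive1E derive_val.
by rewrite expRN -(ler_pM2l (expR_gt0 (r * t))) mulVKf// gt_eqF// expR_gt0.
Qed.

Lemma mirror_state eta muphi Lphi f phi (z x : R -> 'cV[R]_d) (t : R) :
  S_class muphi Lphi phi -> 0 < muphi -> 0 < Lphi ->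
  mirror_descent eta f phi z x -> 0 <= t -> z t = grad phi (x t).
Proof.
move=> phi_S muphi0 Lphi0 [_ _ xE] t0.
have [y yE] := grad_surj _ _ _ (z t) phi_S muphi0 Lphi0.
by rewrite xE// -yE (grad_conjugate _ _ _ _ phi_S).
Qed.

(** The Lyapunov estimate.  It is carried out on the dual expression [W] of the
    divergence because only [z] is known to be differentiable in time. *)
Lemma bregman_decay eta rho muf Lf muphi Lphi f phi xopt
    (z x : R -> 'cV[R]_d) (t : R) :
  S_class muf Lf f -> 0 < muf -> 0 < Lf ->
  S_class muphi Lphi phi -> 0 < muphi -> 0 < Lphi ->
  0 < eta -> is_minimizer f xopt ->
  rho <= eta * muf / Lphi ->
  mirror_descent eta f phi z x -> 0 <= t ->
  bregman phi xopt (x t) <= expR (- (2 * rho * t)) * bregman phi xopt (x 0).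
Proof.
move=> f_S muf0 Lf0 phi_S muphi0 Lphi0 eta0 xoptP rho_le md t0.
have [cz dz xE] := md.
have zE := mirror_state _ _ _ _ _ _ _ _ phi_S muphi0 Lphi0 md.
have gopt : grad f xopt = 0.
  apply: (grad_of_minimizer _ _ _ _ _ f_S Lf0) => w.
  by rewrite !dot0p !subr0.
pose W s := convex_conjugate phi (z s) - convex_conjugate phi (grad phi xopt)
   - dotp xopt (z s - grad phi xopt).
have WE s : 0 <= s -> W s = bregman phi xopt (x s).
  by move=> s0; rewrite /W zE// (conjugate_bregman _ _ _ _ _ phi_S).
rewrite -!WE//; apply: gronwall_decay => //.
  move=> s; apply: cvgB.
    apply: cvgB; last exact: cvg_cst.
    by apply: (cvg_conjugate _ _ _ _ _ phi_S) => //; exact: cz.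
  apply: cvg_dotp; first exact: cvg_cst.
  by apply: cvgB; [exact: cz|exact: cvg_cst].
move=> s s0; have s0' := ltW s0; have zs := zE s s0'.
have dzs := dz s s0; set v := - eta *: _ in dzs.
exists (dotp (x s - xopt) v).
  have d1 := is_derive_conjugate _ _ _ _ _ _ _ phi_S muphi0 Lphi0 dzs zs.
  have dc (w : 'cV[R]_d) : is_derive s 1 (fun=> w) 0 by exact: is_derive_cst.
  have d2 : is_derive s 1 (fun r => z r - grad phi xopt) v.
    by apply: is_derive_eq; rewrite subr0.
  have d3 := is_derive_dotp _ _ _ _ _ (dc xopt) d2.
  rewrite /W; apply: is_derive_eq.
  by rewrite subr0 dot0p add0r dotpDl dotpNl.
have -> : v = - eta *: (grad f (x s) - grad f xopt).
  by rewrite /v/= -xE// gopt subr0.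
rewrite dotpZr dotpC WE//.
have := bregman_le _ _ _ (x s) xopt phi_S.
rewrite dotp_subC.
have [_ _ /(_ (x s) xopt)] := f_S; rewrite enorm_sqr => /andP[].
have := bregman_ge0 _ _ _ (x s) xopt phi_S muphi0.
have := dotp_ge0 (x s - xopt).
move: (bregman _ _ _) (dotp (grad _ _ - _) _) (dotp _ _) => b q n n0 b0 qn _ bn.
(* dW/dt <= - eta muf n, and n >= 2 b / Lphi by smoothness of phi. *)
apply: (@le_trans _ _ (- (eta * muf * n))).
  by rewrite mulNr lerN2 -mulrA ler_pM2l.
rewrite lerN2; apply: (@le_trans _ _ (2 * (eta * muf / Lphi) * b)).
  by rewrite ler_wpM2r// ler_pM2l.
have -> : eta * muf * n = 2 * (eta * muf / Lphi) * (Lphi / 2 * n) by field; lra.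
by rewrite ler_wpM2l// !mulr_ge0 ?invr_ge0 ?ltW.
Qed.

(** * The matrix inequality *)

(** Testing the block matrix on a vector (v, 0) leaves
    2 (rho - a) (v^T P v) <= 0.  The dimension must be positive for a nonzero v
    to exist. *)
Lemma lmi_rate (a rho : R) (P : 'M[R]_d) N1 (N2 : 'M[R]_(d + d, d)) N3 :
  (1 <= d)%N -> posdefmx P ->
  negsemidefmx (block_mx
    (P *m (- a *: 1%:M) + (- a *: 1%:M)^T *m P + (2 * rho) *: P) N1 N2 N3) ->
  rho <= a.
Proof.
move=> d1 [_ Ppos] [_ /(_ (col_mx (const_mx 1) 0))].
rewrite tr_col_mx mul_row_block mul_row_col trmx0 !mul0mx mulmx0 !addr0.
have v0 : const_mx 1 != 0 :> 'cV[R]_d.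
  apply/eqP => /matrixP /(_ (Ordinal d1) 0); rewrite !mxE => /eqP.
  by rewrite oner_eq0.
have := Ppos _ v0; move: (const_mx 1 : 'cV[R]_d) => v vP.
have -> : P *m (- a *: 1%:M) + (- a *: 1%:M)^T *m P + (2 * rho) *: P =
    (2 * (rho - a)) *: P.
  rewrite scalemx1 tr_scalar_mx mul_mx_scalar mul_scalar_mx -!scalerDl.
  by congr (_ *: _); ring.
rewrite -scalemxAr -scalemxAl mxE pmulr_lle0//; lra.
Qed.

End MirrorDescent.

Theorem theorem3 (R : realType) (d : nat) (eta rho muf Lf muphi Lphi : R)
    (f phi : 'cV[R]_d -> R)
    (d_ge1 : (1 <= d)%N) (eta_gt0 : 0 < eta) (rho_gt0 : 0 < rho)
    (muf_gt0 : 0 < muf) (muf_lt_Lf : muf < Lf)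
    (muphi_gt0 : 0 < muphi) (muphi_lt_Lphi : muphi < Lphi)
    (f_S : S_class muf Lf f) (phi_S : S_class muphi Lphi phi) :
  let mub := Lphi^-1 in
  let Lb := muphi^-1 in
  let A : 'M[R]_d := - (eta * muf * mub) *: 1%:M in
  let B : 'M[R]_(d, d + d) := row_mx (- eta *: 1%:M) (- (eta * muf) *: 1%:M) in
  let C : 'M[R]_(d + d, d) := col_mx (mub *: 1%:M) 1%:M in
  let D : 'M[R]_(d + d) := block_mx 0 1%:M 0 0 in
  let K : 'M[R]_(d + d) := diag2I d (Lf - muf) (Lb - mub) in
  (exists (P : 'M[R]_d) (gamma alpha1 alpha2 : R),
    [/\ posdefmx P, 0 <= gamma, 0 <= alpha1, 0 <= alpha2 &
      let Gamma : 'M[R]_(d + d) := diag2I d 0 gamma in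
      let alpha : 'M[R]_(d + d) := diag2I d alpha1 alpha2 in
      let At := A in
      let Bt := - B in
      let Ct := (alpha + rho *: Gamma) *m C + Gamma *m C *m A in
      let Dt := - (alpha *m D) + alpha *m invmx K - Gamma *m C *m B in
      negsemidefmx
        (block_mx (P *m At + At^T *m P + (2 * rho) *: P) (P *m Bt - Ct^T)
                  (P *m Bt - Ct^T)^T                     (- (Dt + Dt^T)))]) ->
  forall xopt : 'cV[R]_d, is_minimizer f xopt ->
  let zopt := grad phi xopt in
  (exists2 c : R, 0 < c & forall z x : R -> 'cV[R]_d,
     mirror_descent eta f phi z x -> forall t : R, 0 <= t ->
     enorm (z t - zopt) <= c * expR (- (rho * t)) * enorm (z 0 - zopt)) /\
  (exists2 c : R, 0 < c & forall z x : R -> 'cV[R]_d,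
     mirror_descent eta f phi z x -> forall t : R, 0 <= t ->
     enorm (x t - xopt) <= c * expR (- (rho * t)) * enorm (x 0 - xopt)).
Proof.
move=> mub Lb A B C D K [P [gamma [alpha1 [alpha2 [Ppos _ _ _ lmi]]]]].
move=> xopt xoptP zopt.
have rho_le : rho <= eta * muf / Lphi := lmi_rate _ _ _ _ _ _ d_ge1 Ppos lmi.
have Lphi0 : 0 < Lphi := lt_trans muphi_gt0 muphi_lt_Lphi.
have Lf0 : 0 < Lf := lt_trans muf_gt0 muf_lt_Lf.
have decay z x t := bregman_decay _ _ _ _ _ _ _ _ _ z x t f_S muf_gt0 Lf0
  phi_S muphi_gt0 Lphi0 eta_gt0 xoptP rho_le.
have up u : bregman phi xopt u <= Lphi / 2 * dotp (u - xopt) (u - xopt).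
  by rewrite dotp_subC; exact: bregman_le phi_S.
split.
- exists (Lphi / muphi) => [|z x md t t0]; first exact: divr_gt0.
  apply: enorm_le_expR; first by rewrite divr_ge0 ?ltW.
  have zE := mirror_state _ _ _ _ _ _ _ _ phi_S muphi_gt0 Lphi0 md.
  rewrite !zE// /zopt dotp_subC.
  (* c / (2 Lphi) <= V t <= expR (- 2 rho t) V 0, where c = |z t - zopt|^2, and
     V 0 <= Lphi/2 |x 0 - xopt|^2 <= Lphi / (2 muphi^2) |z 0 - zopt|^2. *)
  have lo := bregman_ge_grad _ _ _ (x t) xopt phi_S muphi_gt0 Lphi0.
  have lip := grad_inverse_lipschitz _ _ _ (x 0) xopt phi_S muphi_gt0.
  have bt := decay z x t md t0; have b0 := up (x 0).
  rewrite -(ler_pM2l (_ : 0 < (2 * Lphi)^-1)) ?invr_gt0 ?mulr_gt0//.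
  apply: (le_trans lo); apply: (le_trans bt).
  rewrite 2!(mulrCA _ (expR _)) ler_wpM2l ?expR_ge0//.
  apply: (le_trans b0).
  have -> : Lphi / 2 * dotp (x 0 - xopt) (x 0 - xopt) = (2 * Lphi)^-1 *
      ((Lphi / muphi) ^+ 2 * (muphi ^+ 2 * dotp (x 0 - xopt) (x 0 - xopt))).
    by field; rewrite !gt_eqF.
  apply: ler_wpM2l; first by rewrite invr_ge0 mulr_ge0 // ltW.
  exact: ler_wpM2l (sqr_ge0 _) _ _ lip.
- exists (Num.sqrt (Lphi / muphi)) => [|z x md t t0].
    by rewrite sqrtr_gt0 divr_gt0.
  apply: enorm_le_expR; first exact: sqrtr_ge0.
  rewrite sqr_sqrtr; last by rewrite divr_ge0 ?ltW.
  have lo := bregman_ge _ _ _ (x t) xopt phi_S; rewrite dotp_subC in lo.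
  have bt := decay z x t md t0; have b0 := up (x 0).
  rewrite -(ler_pM2l (_ : 0 < muphi / 2)) ?divr_gt0//.
  apply: (le_trans lo); apply: (le_trans bt).
  rewrite 2!(mulrCA _ (expR _)) ler_wpM2l ?expR_ge0//.
  suff -> : muphi / 2 * (Lphi / muphi * dotp (x 0 - xopt) (x 0 - xopt)) =
      Lphi / 2 * dotp (x 0 - xopt) (x 0 - xopt) by [].
  by field; rewrite gt_eqF.
Qed.
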